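(* For all $A:\mathsf{Type}$ and $B:A\to\mathsf{Type}$, the map $\Sigma\text{-isolate}_{A,B}:\sum_{a_0:A^{\circ}}B(a_0)^{\circ}\to\big(\sum_{a:A}B(a)\big)^{\circ}$, sending $(a_0,b_0)$ to $(a_0,b_0)$, is an embedding.
   Context: Homotopy Type Theory. A point $a:A$ is isolated if $\prod_{b:A}\mathrm{Dec}(a=b)$ holds; $A^{\circ}$ is the subtype of isolated points. If $a_0:A$ and $b_0:B(a_0)$ are both isolated then $(a_0,b_0)$ is isolated in $\sum_{a:A}B(a)$, which makes $\Sigma\text{-isolate}_{A,B}$ well-defined (being isolated is a proposition). *)

(* Defs.v *)
From Stdlib Require Import Eqdep_dec.

Definition Dec (P : Type) : Type := (P + (P -> False))%type.

Definition isolated {A : Type} (a : A) : Type := forall b : A, Dec (a = b).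

Definition isolated_points (A : Type) : Type := {a : A & isolated a}.

Definition hfiber {X Y : Type} (f : X -> Y) (y : Y) : Type :=
  {x : X & f x = y}.
Definition IsProp (X : Type) : Type := forall x y : X, x = y.
Definition IsEmbedding {X Y : Type} (f : X -> Y) : Type :=
  forall y : Y, IsProp (hfiber f y).

Lemma sigT_snd_eq_isolated {A : Type} {B : A -> Type} (a0 : A)
  (ia : isolated a0) (b b' : B a0) :
  existT B a0 b = existT B a0 b' -> b = b'.
Proof.
  intro e.
  assert (G : forall (s : {x : A & B x}) (p : existT B a0 b = s),
             eq_rect a0 B b (projT1 s) (f_equal (@projT1 A B) p) = projT2 s).
  { intros s p. destruct p. reflexivity. }
  assert (H : exists q : a0 = a0, eq_rect a0 B b a0 q = b').
  { exists (f_equal (@projT1 A B) e). exact (G _ e). }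
  destruct H as [q Hq].
  assert (Hd : forall y : A, a0 = y \/ a0 <> y).
  { intro y. destruct (ia y) as [p|np]; [left; exact p | right; exact np]. }
  rewrite (eq_proofs_unicity_on Hd q eq_refl) in Hq. exact Hq.
Qed.

Definition sigma_isolated {A : Type} {B : A -> Type} (a0 : A) (b0 : B a0)
  (ia : isolated a0) (ib : isolated b0) : isolated (existT B a0 b0).
Proof.
  intros [a b]. destruct (ia a) as [p | np].
  - destruct p. destruct (ib b) as [q | nq].
    + left. destruct q. reflexivity.
    + right. intro e. apply nq. exact (sigT_snd_eq_isolated a0 ia b0 b e).
  - right. intro e. apply np. exact (f_equal (@projT1 A B) e).
Defined.

Definition sigma_isolate (A : Type) (B : A -> Type) :
  {x : isolated_points A & isolated_points (B (projT1 x))} ->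
  isolated_points {a : A & B a} :=
  fun u =>
    existT _ (existT B (projT1 (projT1 u)) (projT1 (projT2 u)))
      (sigma_isolated (projT1 (projT1 u)) (projT1 (projT2 u))
         (projT2 (projT1 u)) (projT2 (projT2 u))).

(* Main.v *)
(* Paths out of an isolated point are decidable, so by Hedberg's argument any
   two of them are equal, and (with function extensionality) being isolated is
   a proposition.  Hence a point of A° is determined by its underlying point
   and A° is a set.  Σ-isolate is therefore injective, and an injective map
   into a set is an embedding. *)
Require Import Defs.
From Stdlib Require Import Eqdep_dec FunctionalExtensionality.

Lemma isolated_eq_irrelevance {X : Type} (a : X) (ia : isolated a) (b : X)
  (p q : a = b) : p = q.
Proof.
  apply eq_proofs_unicity_on. intro y.
  destruct (ia y) as [r | nr]; [left | right]; assumption.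
Qed.

Lemma isolated_is_prop {X : Type} (a : X) : IsProp (isolated a).
Proof.
  intros i j. apply functional_extensionality_dep. intro b.
  destruct (i b) as [p | np], (j b) as [q | nq].
  - f_equal. apply (isolated_eq_irrelevance a i).
  - destruct (nq p).
  - destruct (np q).
  - f_equal. apply functional_extensionality. intro x. destruct (np x).
Qed.

Lemma isolated_points_inj {X : Type} (u v : isolated_points X) :
  projT1 u = projT1 v -> u = v.
Proof.
  destruct u as [x ix], v as [y iy]. simpl. intro exy. subst y.
  rewrite (isolated_is_prop x ix iy). reflexivity.
Qed.

Lemma isolated_points_eq_irrelevance {X : Type} (u v : isolated_points X)
  (p q : u = v) : p = q.
Proof.
  apply eq_proofs_unicity. clear. intros u v.
  destruct (projT2 u (projT1 v)) as [e | ne].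
  - left. apply isolated_points_inj. exact e.
  - right. intro euv. apply ne. rewrite euv. reflexivity.
Qed.

Lemma injective_into_set_is_embedding {X Y : Type} (f : X -> Y) :
  (forall (y y' : Y) (p q : y = y'), p = q) ->
  (forall x x', f x = f x' -> x = x') -> IsEmbedding f.
Proof.
  intros uipY f_inj y [x p] [x' p'].
  assert (exx' : x = x') by (apply f_inj; rewrite p, p'; reflexivity).
  subst x'. rewrite (uipY _ _ p p'). reflexivity.
Qed.

Lemma sigma_isolate_inj (A : Type) (B : A -> Type) u v :
  sigma_isolate A B u = sigma_isolate A B v -> u = v.
Proof.
  destruct u as [[a ia] [b ib]], v as [[a' ia'] [b' ib']].
  intro e. apply (f_equal (@projT1 _ _)) in e. simpl in e.
  assert (eaa' : a = a') by exact (f_equal (@projT1 _ _) e).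
  subst a'. rewrite (isolated_is_prop a ia ia').
  assert (ebb' : b = b') by exact (sigT_snd_eq_isolated a ia b b' e).
  subst b'. rewrite (isolated_is_prop b ib ib'). reflexivity.
Qed.

Theorem proposition2p12 (A : Type) (B : A -> Type) :
  IsEmbedding (sigma_isolate A B).
Proof.
  apply injective_into_set_is_embedding.
  - apply isolated_points_eq_irrelevance.
  - apply sigma_isolate_inj.
Qed.
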